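(* Let $X$ be a pointed metric space and $E$ a Banach space over $\mathbb{K}$. Then $\pi=L$ on $X\boxtimes E$.
   Context: $\mathbb{K}$ is $\mathbb{R}$ or $\mathbb{C}$. A pointed metric space $X$ is a metric space (with metric $d$) with a distinguished base point $0$. For a pointed metric space $X$ and a Banach space $F$, $\mathrm{Lip}_0(X,F)$ is the Banach space of all Lipschitz maps $f\colon X\to F$ with $f(0)=0$, normed by the least Lipschitz constant $\mathrm{Lip}(f)$. $E^*$ is the topological dual of $E$ and $\langle\phi,e\rangle=\phi(e)$; $V'$ denotes the algebraic dual of a vector space $V$. For $x,y\in X$ and $e\in E$, $\delta_{(x,y)}\boxtimes e\in \mathrm{Lip}_0(X,E^* )'$ is the linear functional $f\mapsto\langle f(x)-f(y),e\rangle$. The Lipschitz tensor product $X\boxtimes E$ is the linear subspace of $\mathrm{Lip}_0(X,E^* )'$ spanned by all the functionals $\delta_{(x,y)}\boxtimes e$ with $x,y\in X$, $e\in E$. Every $u\in X\boxtimes E$ can be written (non-uniquely) as $u=\sum_{i=1}^n\delta_{(x_i,y_i)}\boxtimes e_i$. For $u\in X\boxtimes E$, the Lipschitz projective norm is $$\pi(u)=\inf\left\{\sum_{i=1}^n d(x_i,y_i)\|e_i\|\colon u=\sum_{i=1}^n\delta_{(x_i,y_i)}\boxtimes e_i\right\},$$ the infimum being over all representations of $u$, and, for $u=\sum_{i=1}^n \delta_{(x_i,y_i)}\boxtimes e_i$, $$L(u)=\sup\left\{\left|\sum_{i=1}^n \langle f(x_i)-f(y_i),e_i\rangle\right|\colon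 f\in\mathrm{Lip}_0(X,E^* ),\ \mathrm{Lip}(f)\leq 1 \right\}.$$ *)

(* Defs.v *)
From HB Require Import structures.
From mathcomp Require Import all_boot all_order all_algebra.
From mathcomp Require Import complex.
From mathcomp Require Import all_classical all_reals all_analysis.

Set Implicit Arguments.
Unset Strict Implicit.
Unset Printing Implicit Defensive.
Import Order.TTheory GRing.Theory Num.Theory.
Import numFieldNormedType.Exports.

Local Open Scope classical_set_scope.
Local Open Scope ring_scope.

Variant scalar_kind := RealScalars | ComplexScalars.

Definition scalar_field (R : realType) (k : scalar_kind) : numFieldType :=
  match k with
  | RealScalars => R
  | ComplexScalars => R[i]
  end.

(* Norms over a [numFieldType] K take their values in K itself, also for
   K = R[i]; [reK] and [ofR] translate between these and the reals. *)
Definition ofR (R : realType) (k : scalar_kind) : R -> scalar_field R k :=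
  match k with
  | RealScalars => fun r => r
  | ComplexScalars => fun r => r%:C%C
  end.

Definition reK (R : realType) (k : scalar_kind) : scalar_field R k -> R :=
  match k with
  | RealScalars => fun z => z
  | ComplexScalars => fun z => complex.Re z
  end.

Section ScalarTheory.
Context {R : realType} {k : scalar_kind}.
Local Notation K := (scalar_field R k).

Lemma reKD (x y : K) : reK (x + y) = reK x + reK y.
Proof. by case: k x y => //= -[a b] [c d]. Qed.

Lemma ofRK : cancel (@ofR R k) (@reK R k).
Proof. by case: k. Qed.

Lemma reK_ge0K (x : K) : 0 <= x -> ofR k (reK x) = x.
Proof.
by case: k x => //= x x0; rewrite RRe_real// ger0_real.
Qed.

Lemma ler_ofR (a b : R) : (ofR k a <= ofR k b) = (a <= b).
Proof. by case: k => //=; rewrite lecR. Qed.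

Lemma ofRD (a b : R) : ofR k (a + b) = ofR k a + ofR k b.
Proof. by case: k => //=; rewrite rmorphD. Qed.

Lemma ofRM (a b : R) : ofR k (a * b) = ofR k a * ofR k b.
Proof. by case: k => //=; rewrite rmorphM. Qed.

Lemma ofR0 : ofR k 0 = 0 :> K.
Proof. by case: k => //=; rewrite rmorph0. Qed.

Lemma ofR1 : ofR k 1 = 1 :> K.
Proof. by case: k => //=; rewrite rmorph1. Qed.

Lemma ofRV (a : R) : ofR k a^-1 = (ofR k a)^-1.
Proof. by case: k => //=; rewrite fmorphV. Qed.

Lemma reK_ge0 (x : K) : 0 <= x -> 0 <= reK x.
Proof. by move=> x0; rewrite -ler_ofR reK_ge0K// ofR0. Qed.

Lemma ofR_inj : injective (@ofR R k).
Proof. exact: can_inj ofRK. Qed.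

End ScalarTheory.

(* The norm of a normed space over K, as a real number. *)
Definition rnorm (R : realType) (k : scalar_kind)
  (V : normedModType (scalar_field R k)) (v : V) : R := reK `|v|.

Section NormTheory.
Context {R : realType} {k : scalar_kind}.
Variable V : normedModType (scalar_field R k).
Implicit Types v w : V.

Lemma ofR_rnorm v : ofR k (rnorm v) = `|v|.
Proof. exact: reK_ge0K. Qed.

Lemma rnorm_ge0 v : 0 <= rnorm v.
Proof. by rewrite -(@ler_ofR _ k) ofR_rnorm ofR0. Qed.

Lemma rnormD v w : rnorm (v + w) <= rnorm v + rnorm w.
Proof. by rewrite -(@ler_ofR _ k) ofRD !ofR_rnorm; exact: ler_normD. Qed.

Lemma rnorm0 : rnorm (0 : V) = 0.
Proof. by apply: (@ofR_inj _ k); rewrite ofR_rnorm ofR0 normr0. Qed.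

Lemma rnorm_eq0 v : rnorm v = 0 -> v = 0.
Proof.
by move=> v0; apply/eqP; rewrite -normr_eq0 -ofR_rnorm v0 ofR0.
Qed.

Lemma rnormZ (a : scalar_field R k) v :
  rnorm (a *: v) = reK `|a| * rnorm v.
Proof.
by apply: (@ofR_inj _ k); rewrite ofRM !ofR_rnorm reK_ge0K// normrZ.
Qed.

End NormTheory.

Section AlgebraicDual.
Context {K : numFieldType}.
Variable V : lmodType K.

Definition algdual_pred : {pred V -> K^o} := [pred u | `[< linear u >]].

Record algdual :=
  AlgDual { algdual_fun :> V -> K^o ; _ : algdual_fun \in algdual_pred }.

HB.instance Definition _ := [isSub for algdual_fun].
HB.instance Definition _ := [Choice of algdual by <:].

Lemma algdual_pred_closed : subsemimod_closed algdual_pred.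
Proof.
split; first split.
- by rewrite inE => a v w; rewrite scaler0 addr0.
- move=> f g /asboolP lf /asboolP lg; rewrite inE => a v w.
  by rewrite !addrfctE lf lg scalerDr addrACA.
- move=> c f /asboolP lf; rewrite inE => a v w.
  by rewrite !scalrfctE lf scalerDr !scalerA mulrC.
Qed.

HB.instance Definition _ :=
  GRing.isSubmodClosed.Build K (V -> K^o) algdual_pred algdual_pred_closed.
HB.instance Definition _ := [SubChoice_isSubLmodule of algdual by <:].

Lemma algdual_linear (u : algdual) : linear u.
Proof. by case: u => u /= /asboolP. Qed.

HB.instance Definition _ (u : algdual) :=
  GRing.isLinear.Build K V K^o *:%R u (algdual_linear u).

End AlgebraicDual.


Section ContinuousDual.
Context {R : realType} {k : scalar_kind}.
Local Notation K := (scalar_field R k).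
Variable E : normedModType K.

Definition dual_pred : {pred E -> K^o} :=
  [pred phi | `[< linear phi /\ continuous phi >]].

Record dual := Dual { dual_fun :> E -> K^o ; _ : dual_fun \in dual_pred }.

HB.instance Definition _ := [isSub for dual_fun].
HB.instance Definition _ := [Choice of dual by <:].

Lemma dual_pred_closed : subsemimod_closed dual_pred.
Proof.
split; first split.
- rewrite inE; split; first by move=> a v w; rewrite scaler0 addr0.
  exact: cst_continuous.
- move=> f g /asboolP[lf cf] /asboolP[lg cg]; rewrite inE; split.
    by move=> a v w; rewrite !addrfctE lf lg scalerDr addrACA.
  by move=> x; apply: continuousD; [exact: cf|exact: cg].
- move=> c f /asboolP[lf cf]; rewrite inE; split.
    by move=> a v w; rewrite !scalrfctE lf scalerDr !scalerA mulrC.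
  by move=> x; apply: continuousZl_tmp; exact: cf.
Qed.

HB.instance Definition _ :=
  GRing.isSubmodClosed.Build K (E -> K^o) dual_pred dual_pred_closed.
HB.instance Definition _ := [SubChoice_isSubLmodule of dual by <:].

Lemma dual_linear (phi : dual) : linear phi.
Proof. by case: phi => phi /= /asboolP[]. Qed.

HB.instance Definition _ (phi : dual) :=
  GRing.isLinear.Build K E K^o *:%R phi (dual_linear phi).

Lemma dual_continuous (phi : dual) : continuous phi.
Proof. by case: phi => phi /= /asboolP[]. Qed.

Definition dual_norm (phi : dual) : R :=
  sup [set reK `|phi e : K| | e in [set e : E | rnorm e <= 1]].

Lemma dual_norm_has_sup (phi : dual) :
  has_sup [set reK `|phi e : K| | e in [set e : E | rnorm e <= 1]].
Proof.
split.
  by exists (reK `|phi 0 : K|), 0 => //=; rewrite rnorm0.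
have /linear_boundedP/pinfty_ex_gt0[r r0 phir] :
    bounded_near (phi : {linear E -> K^o}) (nbhs (0 : E)).
  by apply/linear_bounded_continuous; exact: dual_continuous.
exists (reK r) => _ [e /= e1 <-].
rewrite -(@ler_ofR _ k) !reK_ge0K//; last exact: ltW.
apply: (le_trans (phir e)); rewrite ler_piMr ?(ltW r0)//.
by rewrite -ofR_rnorm -(@ofR1 _ k) ler_ofR.
Qed.

Lemma dual_norm_ge0 (phi : dual) : 0 <= dual_norm phi.
Proof.
apply: le_trans (ub_le_sup (dual_norm_has_sup phi).2 _); last first.
  by exists 0 => //=; rewrite rnorm0.
by rewrite reK_ge0.
Qed.

Lemma ler_dual_norm (phi : dual) (e : E) :
  reK `|phi e : K| <= dual_norm phi * rnorm e.
Proof.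
have [->|e0] := eqVneq e 0.
  by rewrite linear0 rnorm0 mulr0 normr0 -(@ler_ofR _ k) reK_ge0K// ofR0.
have ne0 : 0 < rnorm e.
  rewrite lt_neqAle rnorm_ge0 andbT eq_sym.
  by apply: contra e0 => /eqP/rnorm_eq0 ->.
have iK : ofR k (rnorm e)^-1 = `|e|^-1.
  by rewrite ofRV ofR_rnorm.
rewrite -ler_pdivrMr//; apply: ub_le_sup (dual_norm_has_sup phi).2 _ _.
exists (ofR k (rnorm e)^-1 *: e) => /=.
  rewrite -(@ler_ofR _ k) ofR_rnorm normrZ iK normfV normr_id mulVf ?normr_eq0//.
  by rewrite ofR1.
apply: (@ofR_inj _ k); rewrite linearZ/= ofRM !reK_ge0K// normrM iK.
by rewrite normfV normr_id mulrC.
Qed.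

Lemma dual_norm_le (phi : dual) (C : R) :
  (forall e : E, rnorm e <= 1 -> reK `|phi e : K| <= C) -> dual_norm phi <= C.
Proof.
move=> phiC; apply: ge_sup (dual_norm_has_sup phi).1 _ => _ [e /= + <-].
exact: phiC.
Qed.

(* The norm of [dual] has its values in K. *)
Let dnorm (phi : dual) : K := ofR k (dual_norm phi).

Let dnormD (phi psi : dual) : dnorm (phi + psi) <= dnorm phi + dnorm psi.
Proof.
rewrite -ofRD ler_ofR; apply: dual_norm_le => e e1.
have le1 chi : dual_norm chi * rnorm e <= dual_norm chi.
  by rewrite ler_piMr ?dual_norm_ge0.
rewrite (le_trans _ (lerD (le1 phi) (le1 psi)))//.
apply: le_trans (lerD (ler_dual_norm phi e) (ler_dual_norm psi e)).
by rewrite -(@ler_ofR _ k) ofRD !reK_ge0K// ler_normD.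
Qed.

Let dnormZ_le (c : K) (phi : dual) :
  dual_norm (c *: phi) <= reK `|c| * dual_norm phi.
Proof.
apply: dual_norm_le => e e1.
rewrite (_ : reK _ = reK `|c| * reK `|phi e : K|); last first.
  by apply: (@ofR_inj _ k); rewrite ofRM !reK_ge0K// -normrM.
have c0 : 0 <= reK `|c| by rewrite reK_ge0.
rewrite ler_wpM2l// (le_trans (ler_dual_norm _ _))//.
by rewrite ler_piMr ?dual_norm_ge0.
Qed.

Let dnormZ (c : K) (phi : dual) : dnorm (c *: phi) = `|c| * dnorm phi.
Proof.
rewrite -[in RHS](@reK_ge0K _ _ `|c|)// -ofRM; congr ofR.
apply/eqP; rewrite eq_le dnormZ_le/=.
have [->|c0] := eqVneq c 0.
  rewrite normr0 (_ : reK 0 = 0) ?mul0r ?dual_norm_ge0//.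
  by rewrite -(@ofR0 _ k) ofRK.
have c_gt0 : 0 < reK `|c|.
  rewrite lt_neqAle -(@ler_ofR _ k) reK_ge0K// ofR0 normr_ge0 andbT.
  apply: contra c0 => /eqP c0; rewrite -normr_eq0.
  by rewrite -(@reK_ge0K _ _ `|c|)// -c0 ofR0.
rewrite -ler_pdivlMl//.
rewrite (_ : (reK _)^-1 = reK `|c^-1|); last first.
  by apply: (@ofR_inj _ k); rewrite ofRV !reK_ge0K// normfV.
by apply: le_trans (dnormZ_le _ _); rewrite scalerA mulVf// scale1r.
Qed.

Let dnorm_eq0 (phi : dual) : dnorm phi = 0 -> phi = 0.
Proof.
rewrite -(@ofR0 _ k) => /ofR_inj phi0; apply/val_inj/funext => e /=.
apply/eqP; rewrite -normr_eq0 -(@reK_ge0K _ _ `|phi e : K|)//.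
rewrite -(@ofR0 _ k); apply/eqP; congr ofR; apply/eqP; rewrite eq_le.
have := ler_dual_norm phi e; rewrite phi0 mul0r => ->/=.
by rewrite reK_ge0.
Qed.

HB.instance Definition _ :=
  @Lmodule_isNormed.Build K dual dnorm dnormD dnormZ dnorm_eq0.

Lemma rnorm_dualE (phi : dual) : rnorm phi = dual_norm phi.
Proof. by rewrite /rnorm/= ofRK. Qed.

End ContinuousDual.

Section Lip0.
Context {R : realType} {k : scalar_kind}.
Local Notation K := (scalar_field R k).
Variables (X : metricType R) (o : X) (F : normedModType K).

Definition lipschitz_constant (f : X -> F) (C : R) : Prop :=
  0 <= C /\ forall x y, rnorm (f x - f y) <= C * mdist x y.

Definition Lip0_pred : {pred X -> F} :=
  [pred f | `[< f o = 0 /\ exists C, lipschitz_constant f C >]].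

Record Lip0 := MkLip0 { Lip0_fun :> X -> F ; _ : Lip0_fun \in Lip0_pred }.

HB.instance Definition _ := [isSub for Lip0_fun].
HB.instance Definition _ := [Choice of Lip0 by <:].

Lemma Lip0_pred_closed : subsemimod_closed Lip0_pred.
Proof.
split; first split.
- rewrite inE; split=> //; exists 0; split=> // x y.
  by rewrite subrr rnorm0 mul0r.
- move=> f g /asboolP[f0 [C [C0 fC]]] /asboolP[g0 [D [D0 gD]]].
  rewrite inE; split; first by rewrite addrfctE f0 g0 addr0.
  exists (C + D); split=> [|x y]; first exact: addr_ge0.
  rewrite !addrfctE opprD addrACA mulrDl.
  by rewrite (le_trans (rnormD _ _))// lerD.
- move=> c f /asboolP[f0 [C [C0 fC]]]; rewrite inE.
  have c0 : 0 <= reK `|c| by rewrite reK_ge0.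
  split; first by rewrite scalrfctE f0 scaler0.
  exists (reK `|c| * C); split=> [|x y]; first exact: mulr_ge0.
  by rewrite !scalrfctE -scalerBr rnormZ -mulrA ler_wpM2l.
Qed.

HB.instance Definition _ :=
  GRing.isSubmodClosed.Build K (X -> F) Lip0_pred Lip0_pred_closed.
HB.instance Definition _ := [SubChoice_isSubLmodule of Lip0 by <:].

Definition Lip (f : Lip0) : R := inf [set C | lipschitz_constant f C].

(* The infimum is attained: [Lip f] is itself a Lipschitz constant. *)
Lemma Lip_least (f : Lip0) : lipschitz_constant f (Lip f).
Proof.
case: f => f f_Lip0; rewrite /Lip/=; move/asboolP: f_Lip0 => [_ [C fC]].
have lbf : has_lbound [set C | lipschitz_constant f C] by exists 0 => D [].
have f0 : [set C | lipschitz_constant f C] !=set0 by exists C.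
split=> [|x y]; first by apply: lb_le_inf => // D [].
have := mdist_ge0 x y; rewrite le_eqVlt => /predU1P[d0|d0].
  by rewrite -d0 mulr0; have := fC.2 x y; rewrite -d0 mulr0.
by rewrite -ler_pdivrMr//; apply: lb_le_inf => // D [_ fD]; rewrite ler_pdivrMr.
Qed.

End Lip0.

Definition linear_span (K : numFieldType) (V : lmodType K) (A : set V) :
    set V :=
  [set v | exists2 s : seq (K * V), (forall p, p \in s -> A p.2) &
                                    v = \sum_(p <- s) p.1 *: p.2].

Section LipschitzTensor.
Context {R : realType} {k : scalar_kind}.
Local Notation K := (scalar_field R k).
Variables (X : metricType R) (o : X) (E : normedModType K).

Local Notation Lip0_dual := (Lip0 o (dual E)).

Definition elem_tensor_fun (x y : X) (e : E) (f : Lip0_dual) : K^o :=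
  (f x - f y) e.

Lemma elem_tensor_linear (x y : X) (e : E) :
  elem_tensor_fun x y e \in @algdual_pred _ Lip0_dual.
Proof.
rewrite inE => a f g; rewrite /elem_tensor_fun/=.
by rewrite !(addrfctE, opprfctE, scalrfctE)/= opprD addrACA -scalerBr.
Qed.

Definition elem_tensor (x y : X) (e : E) : algdual Lip0_dual :=
  AlgDual (elem_tensor_linear x y e).

Definition lip_tensor : set (algdual Lip0_dual) :=
  linear_span [set u | exists x y e, u = elem_tensor x y e].

(* A representation is a list of triples ((x_i, y_i), e_i). *)
Definition tensor_of (s : seq (X * X * E)) : algdual Lip0_dual :=
  \sum_(p <- s) elem_tensor p.1.1 p.1.2 p.2.

Definition lip_projective_norm (u : algdual Lip0_dual) : R :=
  inf [set r | exists2 s : seq (X * X * E), u = tensor_of s &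
                 r = \sum_(p <- s) mdist p.1.1 p.1.2 * rnorm p.2].

Definition lip_dual_norm (u : algdual Lip0_dual) : R :=
  sup [set reK `|u f : K| | f in [set f : Lip0_dual | Lip f <= 1]].

Lemma tensor_ofE (s : seq (X * X * E)) (f : Lip0_dual) :
  tensor_of s f = \sum_(p <- s) (f p.1.1 - f p.1.2) p.2.
Proof.
rewrite /tensor_of; elim: s => [|p s IHs]; first by rewrite !big_nil.
by rewrite !big_cons/= addrfctE IHs.
Qed.

Lemma lip_dual_norm_tensor_of (s : seq (X * X * E)) :
  lip_dual_norm (tensor_of s) =
  sup [set reK `|\sum_(p <- s) (f p.1.1 - f p.1.2) p.2 : K| |
        f in [set f : Lip0_dual | Lip f <= 1]].
Proof. by congr sup; apply: eq_imagel => f _; rewrite tensor_ofE. Qed.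

End LipschitzTensor.

Arguments lip_tensor {R k X} o E _.

(* Main.v *)
Require Import Defs.
From HB Require Import structures.
From mathcomp Require Import all_boot all_order all_algebra.
From mathcomp Require Import complex.
From mathcomp Require Import all_classical all_reals all_analysis.
From mathcomp Require Import ring lra.

Set Implicit Arguments.
Unset Strict Implicit.
Unset Printing Implicit Defensive.
Import Order.TTheory GRing.Theory Num.Theory.
Import numFieldNormedType.Exports.

Local Open Scope classical_set_scope.
Local Open Scope ring_scope.

(** Let W be the Lipschitz tensor product, spanned by the elementary tensors.

The inequality L <= pi is a term-by-term estimate: a map f with Lip f <= 1
satisfies |<f x - f y, e>| <= d(x, y) |e|, so a representation of u bounds
|u(f)| by its cost (lip_tensor_eval_le).

Conversely pi is a seminorm on W: representations are concatenated and scaled.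
By the Hahn-Banach theorem there is a linear functional Phi on W with
|Phi| <= pi everywhere and |Phi u| >= pi u. Such a Phi is the evaluation at a
Lipschitz map, namely f x := (e |-> Phi (elem_tensor o x o e)): indeed
<f x - f y, e> = Phi (elem_tensor o x y e) has modulus at most
pi (elem_tensor o x y e) <= d(x, y) |e|, so that f takes its values in the dual
of E and Lip f <= 1, and Phi agrees with evaluation at f on the generators of
W (bounded_functional_eval). Hence pi u <= |Phi u| = |u(f)| <= L u.

The Hahn-Banach theorem is proved through minimal sublinear functionals. Zorn's
lemma yields a minimal sublinear functional below a given one; no functional is
extended from a subspace, so only total functions are compared. For each vector
a, a sublinear q lies above a sublinear r with r (- a) <= - q a
(sublinear_steepen). For a minimal q this forces q (- a) = - q a, whence q is
linear; applied once to the dominating functional, the same construction also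
makes it touch that functional at a prescribed vector. Over the complex numbers,
a real-linear functional q is the real part of v |-> q v - i q (i v), and a
rotation of v turns a bound on the real part into one on the modulus. *)

(** * The real Hahn-Banach theorem *)

Section Sublinear.
Context {R : realType} {k : scalar_kind}.
Variable V : lmodType (scalar_field R k).
Implicit Types (p q : V -> R) (A : set (V -> R)).

(** Only one inequality is asked of positive multiples; scaling back by the
    inverse gives the equality, see [sublinearZ]. *)
Definition sublinear q : Prop :=
  (forall v w, q (v + w) <= q v + q w) /\
  (forall t v, 0 < t -> q (ofR k t *: v) <= t * q v).

Lemma sublinear0 q : sublinear q -> q 0 = 0.
Proof.
move=> [qD qZ]; apply/eqP; rewrite eq_le; apply/andP; split.
  by have := qZ 2^-1 0 ltac:(lra); rewrite scaler0; lra.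
by have := qD 0 0; rewrite addr0; lra.
Qed.

Lemma sublinearZ q t v : sublinear q -> 0 <= t -> q (ofR k t *: v) = t * q v.
Proof.
move=> qs; rewrite le_eqVlt => /predU1P[<-|t0].
  by rewrite ofR0 scale0r mul0r sublinear0.
apply/eqP; rewrite eq_le qs.2//=.
have := qs.2 t^-1 (ofR k t *: v); rewrite invr_gt0 => /(_ t0).
by rewrite scalerA -ofRM mulVf ?gt_eqF// ofR1 scale1r ler_pdivlMl.
Qed.

Lemma sublinearN_ge q v : sublinear q -> - q (- v) <= q v.
Proof.
by move=> qs; have := qs.1 v (- v); rewrite subrr sublinear0//; lra.
Qed.

(** The closure conditions say that the inequalities of sublinearity hold up to
    a change of member within the family, so they pass to the infimum although
    the members need not be sublinear themselves. This form covers both the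
    chains of [sublinear_minimal] and the translates of [sublinear_steepen]. *)
Lemma sublinear_inf A : A !=set0 ->
  (forall v, has_lbound [set q v | q in A]) ->
  (forall q1 q2, A q1 -> A q2 ->
    exists2 q, A q & forall v w, q (v + w) <= q1 v + q2 w) ->
  (forall q t, A q -> 0 < t ->
    exists2 q', A q' & forall v, q' (ofR k t *: v) <= t * q v) ->
  sublinear (fun v => inf [set q v | q in A]).
Proof.
move=> [q0 Aq0] Alb AD AZ.
have infA_le q v : A q -> inf [set q v | q in A] <= q v.
  by move=> Aq; apply: ge_inf => //; exists q.
have le_infA a v : (forall q, A q -> a <= q v) -> a <= inf [set q v | q in A].
  move=> aA; apply: lb_le_inf; first by exists (q0 v), q0.
  by move=> _ [q Aq <-]; exact: aA.
split=> [v w|t v t0].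
  rewrite -lerBlDr; apply: (le_infA) => q1 Aq1.
  rewrite lerBlDr -lerBlDl; apply: (le_infA) => q2 Aq2; rewrite lerBlDl.
  have [q Aq qle] := AD _ _ Aq1 Aq2.
  exact: le_trans (infA_le _ _ Aq) (qle v w).
rewrite -ler_pdivrMl//; apply: (le_infA) => q Aq; rewrite ler_pdivrMl//.
have [q' Aq' qle] := AZ _ _ Aq t0.
exact: le_trans (infA_le _ _ Aq') (qle v).
Qed.

(** Zorn's lemma applies because the pointwise infimum of a chain is finite: a
    sublinear q <= p satisfies q v >= - q (- v) >= - p (- v). *)
Lemma sublinear_minimal p : sublinear p ->
  exists q, [/\ sublinear q, forall v, q v <= p v &
    forall r, sublinear r -> (forall v, r v <= q v) -> r = q].
Proof.
move=> ps.
pose T := {q : V -> R | sublinear q /\ forall v, q v <= p v}.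
pose below (q r : T) : bool := `[< forall v, sval r v <= sval q v >].
have [|r s t||A Atot|[q [qs qp]] qmin] := @Zorn T below.
- by move=> q; apply/asboolP.
- by move=> /asboolP rs /asboolP st; apply/asboolP => v; exact: le_trans (rs v).
- move=> [s sP] [t tP] /asboolP/= st /asboolP/= ts.
  by apply: eq_exist; apply/funext => v; apply/eqP; rewrite eq_le st ts.
- have [[q0 Aq0]|A0] := pselect (A !=set0); last first.
    by exists (exist _ p (conj ps (fun=> lexx _))) => s As; case: A0; exists s.
  pose B := [set sval q | q in A].
  have Blb v : has_lbound [set q v | q in B].
    exists (- p (- v)) => _ [_ [q Aq <-] <-].
    have [qs qp] := svalP q.
    by apply: le_trans (sublinearN_ge v qs); rewrite lerN2.
  have Binf v (q : T) : A q -> inf [set q v | q in B] <= sval q v.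
    by move=> Aq; apply: ge_inf => //; exists (sval q) => //; exists q.
  have Bs : sublinear (fun v => inf [set q v | q in B]).
    apply: sublinear_inf => //; first by exists (sval q0), q0.
    - move=> _ _ [q1 Aq1 <-] [q2 Aq2 <-].
      have [/asboolP le21|/asboolP le12] := Atot _ _ Aq1 Aq2.
      + exists (sval q2) => [|v w]; first by exists q2.
        by apply: le_trans ((svalP q2).1.1 v w) _; rewrite lerD2r.
      + exists (sval q1) => [|v w]; first by exists q1.
        by apply: le_trans ((svalP q1).1.1 v w) _; rewrite lerD2l.
    - move=> _ t [q Aq <-] t0; exists (sval q) => [|v]; first by exists q.
      exact: (svalP q).1.2.
  have Bp v : inf [set q v | q in B] <= p v.
    exact: le_trans (Binf v _ Aq0) ((svalP q0).2 v).
  exists (exist _ (fun v => inf [set q v | q in B]) (conj Bs Bp)) => s As.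
  by apply/asboolP => v /=; exact: Binf.
exists q; split=> // r rs rq.
have rp v : r v <= p v by exact: le_trans (rq v) (qp v).
have := qmin (exist _ r (conj rs rp)); rewrite /below/= => /(_ _)/(congr1 sval).
by apply; apply/asboolP.
Qed.

(** The witness is r v := inf_(t >= 0) (q (v + t a) - t q a): t = 0 gives
    r <= q, and t = 1 gives r (- a) <= - q a. *)
Lemma sublinear_steepen q a : sublinear q ->
  exists r, [/\ sublinear r, forall v, r v <= q v & r (- a) <= - q a].
Proof.
move=> qs.
pose shift t v := q (v + ofR k t *: a) - t * q a.
pose A : set (V -> R) := [set shift t | t in [set t | 0 <= t]].
have Alb v : has_lbound [set r v | r in A].
  exists (- q (- v)) => _ [_ [t /= t0 <-] <-].
  rewrite /shift -(sublinearZ a qs t0).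
  by have := qs.1 (v + ofR k t *: a) (- v); rewrite addrAC subrr add0r; lra.
have Ainf t v : 0 <= t -> inf [set r v | r in A] <= shift t v.
  by move=> t0; apply: ge_inf => //; exists (shift t) => //; exists t.
exists (fun v => inf [set r v | r in A]); split.
- apply: sublinear_inf => //; first by exists (shift 0), 0 => /=.
  + move=> _ _ [s /= s0 <-] [t /= t0 <-].
    exists (shift (s + t)); first by exists (s + t) => //=; exact: addr_ge0.
    move=> v w; rewrite /shift ofRD scalerDl addrACA.
    by have := qs.1 (v + ofR k s *: a) (w + ofR k t *: a); lra.
  + move=> _ t [s /= s0 <-] t0.
    exists (shift (t * s)); first exists (t * s) => //=.
      by rewrite mulr_ge0// ltW.
    move=> v; rewrite /shift ofRM -scalerA -scalerDr.
    by have := qs.2 t (v + ofR k s *: a) t0; lra.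
- move=> v; apply: le_trans (Ainf 0 v _) _ => //.
  by rewrite /shift ofR0 scale0r addr0 mul0r subr0.
- apply: le_trans (Ainf 1 _ _) _ => //.
  by rewrite /shift ofR1 scale1r addNr sublinear0// mul1r sub0r.
Qed.

(** A minimal sublinear functional below p' is odd by [sublinear_steepen], and
    an odd sublinear functional is linear. Starting from a p' <= p with
    p' (- u) <= - p u gives q u = - q (- u) >= p u. *)
Theorem hahn_banach_real p u : sublinear p ->
  exists q, [/\ forall v w, q (v + w) = q v + q w,
                forall t v, q (ofR k t *: v) = t * q v,
                forall v, q v <= p v & q u = p u].
Proof.
move=> ps; have [p' [p's p'p p'u]] := sublinear_steepen u ps.
have [q [qs qp' qmin]] := sublinear_minimal p's.
have qN v : q (- v) = - q v.
  apply/eqP; rewrite eq_le; apply/andP; split; last first.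
    by rewrite lerNl; exact: sublinearN_ge.
  by have [r [rs rq]] := sublinear_steepen v qs; rewrite (qmin _ rs rq).
exists q; split.
- move=> v w; apply/eqP; rewrite eq_le qs.1/=.
  by have := qs.1 (- v) (- w); rewrite -opprD !qN; lra.
- move=> t v; have [t0|t0] := leP 0 t; first exact: sublinearZ.
  (* For t < 0, write t v = (- t) (- v) and use that q is odd. *)
  rewrite -[t]opprK -[q v]opprK mulrNN -qN -sublinearZ//; last by lra.
  congr q; have /eqP : ofR k (- t) + ofR k t = 0 by rewrite -ofRD addNr ofR0.
  by rewrite opprK addr_eq0 => /eqP ->; rewrite scalerN scaleNr opprK.
- by move=> v; exact: le_trans (qp' v) (p'p v).
- apply/eqP; rewrite eq_le (le_trans (qp' u) (p'p u))/=.
  by have := le_trans (qp' (- u)) p'u; rewrite qN lerN2.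
Qed.

End Sublinear.

(** * Real and complex scalars *)

Section Complexification.
Context {R : realType}.

Lemma ler_reK_norm (k : scalar_kind) (z : scalar_field R k) :
  reK z <= reK `|z|.
Proof.
case: k z => /= z; first exact: ler_norm.
have := normc_ge_Re z; rewrite lecE/= => /andP[_]; apply: le_trans.
exact: ler_norm.
Qed.

(** A linear Phi with real part q has imaginary part - Re (i Phi) = - q (i v),
    which leaves a single candidate over the complex numbers. *)
Lemma scalar_extension (k : scalar_kind) (V : lmodType (scalar_field R k))
    (q : V -> R) :
  (forall v w, q (v + w) = q v + q w) ->
  (forall t v, q (ofR k t *: v) = t * q v) ->
  exists Phi : {linear V -> (scalar_field R k)^o},
    forall v, reK (Phi v : scalar_field R k) = q v.
Proof.
move=> qD qZ.
suff [Phi Phil PhiE] : exists2 Phi : V -> (scalar_field R k)^o,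
    linear Phi & forall v, reK (Phi v : scalar_field R k) = q v.
  pose L : {linear V -> (scalar_field R k)^o} :=
    HB.pack Phi (GRing.isLinear.Build _ _ _ _ Phi Phil).
  by exists L.
case: k V q qD qZ => /= V q qD qZ; first by exists q => // a v w; rewrite qD qZ.
have qE a b v : q ((a +i* b)%C *: v) = a * q v + b * q ('i%C *: v).
  rewrite -!qZ -qD scalerA -scalerDl; congr (q (_ *: _)).
  by apply/eqP; rewrite eq_complex/=; apply/andP; split; apply/eqP; ring.
exists (fun v => (q v +i* - q ('i%C *: v))%C) => // -[a b] v w.
suff : ((q ((a +i* b) *: v + w) +i* - q ('i *: ((a +i* b) *: v + w)))
   = (a +i* b) * (q v +i* - q ('i *: v)) + (q w +i* - q ('i *: w)))%C by [].
rewrite scalerDr scalerA.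
have -> : ('i * (a +i* b) = - b +i* a)%C.
  by apply/eqP; rewrite eq_complex/=; apply/andP; split; apply/eqP; ring.
rewrite !qD (qE a b v) (qE (- b) a v).
by apply/eqP; rewrite eq_complex/=; apply/andP; split; apply/eqP; ring.
Qed.

(** The real part of Phi is bounded by p; multiplying v by the scalar c of
    modulus 1 that makes c * Phi v = |Phi v| upgrades this to the modulus. *)
Theorem hahn_banach (k : scalar_kind) (V : lmodType (scalar_field R k))
    (p : V -> R) (u : V) :
  (forall v w, p (v + w) <= p v + p w) ->
  (forall c v, p (c *: v) <= reK `|c| * p v) ->
  exists Phi : {linear V -> (scalar_field R k)^o},
    (forall v, reK `|Phi v : scalar_field R k| <= p v) /\
    p u <= reK `|Phi u : scalar_field R k|.
Proof.
move=> pD pZ.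
have ps : sublinear p.
  split=> // t v t0; apply: le_trans (pZ _ v) _.
  by rewrite ger0_norm ?ofRK// -(@ofR0 _ k) ler_ofR ltW.
have [q [qD qZ qp qu]] := hahn_banach_real u ps.
have [Phi PhiE] := scalar_extension qD qZ.
exists Phi; split=> [v|]; last by rewrite -qu -PhiE ler_reK_norm.
pose z : scalar_field R k := Phi v.
have [c c1 cz] : exists2 c : scalar_field R k, `|c| = 1 & c * z = `|z|.
  have [->|z0] := eqVneq z 0; first by exists 1; rewrite ?normr1 ?mulr0 ?normr0.
  exists (`|z| / z); last by rewrite divfK.
  by rewrite normrM normfV normr_id divff ?normr_eq0.
have -> : `|Phi v : scalar_field R k| = Phi (c *: v) by rewrite linearZ -cz.
rewrite PhiE (le_trans (qp _))// (le_trans (pZ _ _))//.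
by rewrite c1 -(@ofR1 _ k) ofRK mul1r.
Qed.

End Complexification.

(** * The projective norm as a seminorm *)

Section LipTensorNorms.
Context {R : realType} {k : scalar_kind}.
Local Notation K := (scalar_field R k).
Variables (X : metricType R) (o : X) (E : normedModType K).
Local Notation tensor := (algdual (Lip0 o (dual E))).
Implicit Types (u : tensor) (x y : X) (e : E) (s : seq (X * X * E)).

Lemma elem_tensorZ (c : K) x y e :
  c *: elem_tensor o x y e = elem_tensor o x y (c *: e).
Proof.
by apply/val_inj/funext => f /=; rewrite /elem_tensor_fun linearZ.
Qed.

Lemma elem_tensorB z x y e :
  elem_tensor o x z e - elem_tensor o y z e = elem_tensor o x y e.
Proof.
apply/val_inj/funext => f /=; rewrite /elem_tensor_fun.
by have -> : f x - f y = (f x - f z) - (f y - f z) by rewrite opprB addrA subrK.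
Qed.

Definition rep_cost s : R := \sum_(p <- s) mdist p.1.1 p.1.2 * rnorm p.2.

Definition rep_scale (c : K) s := [seq (p.1, c *: p.2) | p <- s].

Lemma tensor_of_cat s1 s2 :
  tensor_of o (s1 ++ s2) = tensor_of o s1 + tensor_of o s2.
Proof. exact: big_cat. Qed.

Lemma tensor_of_scale c s : tensor_of o (rep_scale c s) = c *: tensor_of o s.
Proof.
rewrite /tensor_of big_map scaler_sumr.
by apply: eq_bigr => p _; rewrite elem_tensorZ.
Qed.

Lemma rep_cost_ge0 s : 0 <= rep_cost s.
Proof. by apply: sumr_ge0 => p _; rewrite mulr_ge0 ?mdist_ge0 ?rnorm_ge0. Qed.

Lemma rep_cost_scale c s : rep_cost (rep_scale c s) = reK `|c| * rep_cost s.
Proof.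
rewrite /rep_cost big_map mulr_sumr.
by apply: eq_bigr => p _; rewrite rnormZ mulrCA.
Qed.

(** Scalars of a linear combination are absorbed into the vectors of E, so sums
    of elementary tensors already exhaust their span. *)
Lemma lip_tensorP u : lip_tensor o E u <-> exists s, u = tensor_of o s.
Proof.
split=> [[s sA ->]|[s ->]].
  elim: s sA => [|[c v] s IHs] sA.
    by exists [::]; rewrite /tensor_of !big_nil.
  have [x [y [e /= vE]]] := sA _ (mem_head _ _).
  have [p ps|s' ss'] := IHs; first by apply: sA; rewrite inE ps orbT.
  exists ((x, y, c *: e) :: s').
  by rewrite /tensor_of !big_cons/= ss' vE elem_tensorZ.
exists [seq (1, elem_tensor o p.1.1 p.1.2 p.2) | p <- s].
  by move=> _ /mapP[p _ ->] /=; exists p.1.1, p.1.2, p.2.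
by rewrite /tensor_of big_map; apply: eq_bigr => p _; rewrite scale1r.
Qed.

Lemma lip_projective_norm_le s :
  lip_projective_norm (tensor_of o s) <= rep_cost s.
Proof.
apply: ge_inf; last by exists s.
by exists 0 => _ [s' _ ->]; exact: rep_cost_ge0.
Qed.

(** Membership in the span makes the set of costs nonempty; otherwise its
    infimum would be the conventional value 0. *)
Lemma lip_projective_norm_ge u (a : R) : lip_tensor o E u ->
  (forall s, u = tensor_of o s -> a <= rep_cost s) ->
  a <= lip_projective_norm u.
Proof.
move=> /lip_tensorP[s0 u0] ua; apply: lb_le_inf.
  by exists (rep_cost s0), s0.
by move=> _ [s us ->]; exact: ua.
Qed.

Lemma lip_projective_normD u v : lip_tensor o E u -> lip_tensor o E v ->
  lip_projective_norm (u + v) <= lip_projective_norm u + lip_projective_norm v.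
Proof.
move=> uT vT; rewrite -lerBlDr; apply: lip_projective_norm_ge => // s us.
rewrite lerBlDr -lerBlDl; apply: lip_projective_norm_ge => // t vt.
rewrite lerBlDl us vt -tensor_of_cat (le_trans (lip_projective_norm_le _))//.
by rewrite /rep_cost big_cat.
Qed.

Lemma lip_projective_normZ (c : K) u : lip_tensor o E u ->
  lip_projective_norm (c *: u) <= reK `|c| * lip_projective_norm u.
Proof.
move=> uT.
(* The infimum can be scaled only by a nonzero factor; for c of modulus 0,
   scaling any one representation leaves a cost of 0. *)
have [c0|c0] := eqVneq (reK `|c|) 0.
  have [s us] := (lip_tensorP u).1 uT.
  rewrite us -tensor_of_scale (le_trans (lip_projective_norm_le _))//.
  by rewrite rep_cost_scale c0 !mul0r.
have cp : 0 < reK `|c| by rewrite lt_neqAle eq_sym c0 reK_ge0.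
rewrite -ler_pdivrMl//; apply: lip_projective_norm_ge => // s us.
rewrite ler_pdivrMl// us -tensor_of_scale -rep_cost_scale.
exact: lip_projective_norm_le.
Qed.

(** Term by term, |<f x - f y, e>| <= Lip f * d(x, y) * |e|. *)
Lemma lip_tensor_eval_le u (f : Lip0 o (dual E)) : lip_tensor o E u ->
  Lip f <= 1 -> reK `|u f : K| <= lip_projective_norm u.
Proof.
move=> uT f1; apply: lip_projective_norm_ge => // s ->.
rewrite tensor_ofE -(@ler_ofR _ k) reK_ge0K//.
apply: le_trans (ler_norm_sum _ _ _) _.
rewrite /rep_cost (big_morph _ (@ofRD R k) (@ofR0 R k)).
apply: ler_sum => p _; rewrite -[leLHS]reK_ge0K// ler_ofR.
apply: le_trans (ler_dual_norm _ _) _.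
rewrite -rnorm_dualE ler_wpM2r ?rnorm_ge0//.
apply: le_trans ((Lip_least f).2 _ _) _.
by rewrite ler_piMl ?mdist_ge0.
Qed.

Lemma lip_dual_norm_le u : lip_tensor o E u ->
  lip_dual_norm u <= lip_projective_norm u.
Proof.
move=> uT; apply: ge_sup => [|_ [f f1 <-]]; last exact: lip_tensor_eval_le.
(* The zero map has Lipschitz constant 0: the supremum is over a nonempty set. *)
exists (reK `|u 0 : K|), 0 => //=.
apply: (@le_trans _ _ 0) => //; apply: ge_inf; first by exists 0 => C [].
by split=> // x y; rewrite subrr rnorm0 mul0r.
Qed.

End LipTensorNorms.

(** * The Lipschitz tensor product as a vector space *)

Section LipTensorSpace.
Context {R : realType} {k : scalar_kind}.
Local Notation K := (scalar_field R k).
Variables (X : metricType R) (o : X) (E : normedModType K).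

Definition lip_tensor_pred : {pred algdual (Lip0 o (dual E))} :=
  [pred u | `[< lip_tensor o E u >]].

Lemma lip_tensor_pred_closed : subsemimod_closed lip_tensor_pred.
Proof.
split; first split; rewrite ?inE.
- by apply/lip_tensorP; exists [::]; rewrite /tensor_of big_nil.
- move=> u v /asboolP/lip_tensorP[s ->] /asboolP/lip_tensorP[t ->].
  by rewrite inE -tensor_of_cat; apply/lip_tensorP; exists (s ++ t).
- move=> c u /asboolP/lip_tensorP[s ->].
  by rewrite inE -tensor_of_scale; apply/lip_tensorP; exists (rep_scale c s).
Qed.

(** The span as a vector space of its own: the projective norm is a seminorm
    only there, since its value off the span is the infimum of the empty set. *)
Record lip_tensor_space := LipTensor {
  lip_tensor_val :> algdual (Lip0 o (dual E));
  _ : lip_tensor_val \in lip_tensor_pred }.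

HB.instance Definition _ := [isSub for lip_tensor_val].
HB.instance Definition _ := [Choice of lip_tensor_space by <:].
HB.instance Definition _ := GRing.isSubmodClosed.Build K
  (algdual (Lip0 o (dual E))) lip_tensor_pred lip_tensor_pred_closed.
HB.instance Definition _ := [SubChoice_isSubLmodule of lip_tensor_space by <:].

Lemma lip_tensor_valP (u : lip_tensor_space) : lip_tensor o E u.
Proof. by case: u => u /= /asboolP. Qed.

Lemma elem_tensor_in_pred (x y : X) (e : E) :
  elem_tensor o x y e \in lip_tensor_pred.
Proof.
rewrite inE; apply/lip_tensorP; exists [:: (x, y, e)].
by rewrite /tensor_of big_seq1.
Qed.

Definition space_elem (x y : X) (e : E) : lip_tensor_space :=
  LipTensor (elem_tensor_in_pred x y e).

Lemma space_elem_linear x y : linear (space_elem x y).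
Proof.
move=> a e e'; apply/val_inj => /=; rewrite elem_tensorZ.
by apply/val_inj/funext => f /=; rewrite /elem_tensor_fun linearD.
Qed.

Lemma space_elemB z x y e :
  space_elem x z e - space_elem y z e = space_elem x y e.
Proof. by apply/val_inj; rewrite /= (elem_tensorB _ z). Qed.

End LipTensorSpace.

(** * Bounded functionals on the tensor product are Lipschitz maps *)

Section BoundedDual.
Context {R : realType} {k : scalar_kind}.
Local Notation K := (scalar_field R k).
Variable E : normedModType K.

Lemma bounded_in_dual (phi : E -> K^o) (C : R) : linear phi ->
  (forall e, reK `|phi e : K| <= C * rnorm e) -> phi \in @dual_pred R k E.
Proof.
move=> phil phiC; rewrite inE; split=> //.
pose L : {linear E -> K^o} :=
  HB.pack phi (GRing.isLinear.Build _ _ _ _ phi phil).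
suff : bounded_near L (nbhs (0 : E)) by move/linear_bounded_continuous.
apply/linear_boundedP.
have C0 : ofR k `|C| \is Num.real by rewrite ger0_real// -(@ofR0 _ k) ler_ofR.
near=> r => e.
apply: (@le_trans _ _ (ofR k `|C| * `|e|)).
  rewrite -(ofR_rnorm e) -ofRM -[leLHS]reK_ge0K// ler_ofR.
  by apply: le_trans (phiC e) _; rewrite ler_wpM2r ?rnorm_ge0 ?ler_norm.
by rewrite ler_wpM2r//; near: r; exact: nbhs_pinfty_ge.
Unshelve. all: by end_near. Qed.

End BoundedDual.

Section Representation.
Context {R : realType} {k : scalar_kind}.
Local Notation K := (scalar_field R k).
Variables (X : metricType R) (o : X) (E : normedModType K).
Local Notation W := (lip_tensor_space o E).

(** The map is x |-> (e |-> Phi (space_elem o x o e)). Differences of its values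
    are values of Phi at elementary tensors, whose projective norm is at most
    d(x, y) |e|; this gives at once continuity in e and the Lipschitz bound. *)
Lemma bounded_functional_eval (Phi : {linear W -> K^o}) :
  (forall w : W, reK `|Phi w : K| <= lip_projective_norm (w : algdual _)) ->
  exists2 f : Lip0 o (dual E), Lip f <= 1 & forall w : W, Phi w = w f.
Proof.
move=> PhiP.
have Phi_elem x y e :
    reK `|Phi (space_elem o x y e) : K| <= mdist x y * rnorm e.
  apply: le_trans (PhiP _) _.
  have := lip_projective_norm_le o [:: (x, y, e)].
  by rewrite /rep_cost /tensor_of !big_seq1.
have Phi_lin x : linear (fun e => Phi (space_elem o x o e)).
  by move=> a e e'; rewrite space_elem_linear linearP.
(* The bound with y = o gives the continuity of each functional. *)
have Phi_dual x := bounded_in_dual (Phi_lin x) (Phi_elem x o).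
pose g x : dual E := Dual (Phi_dual x).
have gB x y e : (g x - g y) e = Phi (space_elem o x y e).
  by rewrite -(space_elemB o o) linearB.
have g_lip : lipschitz_constant g 1.
  split=> // x y; rewrite mul1r rnorm_dualE; apply: dual_norm_le => e e1.
  by rewrite gB (le_trans (Phi_elem x y e))// ler_piMr ?mdist_ge0.
have g0 : g o = 0.
  apply/val_inj/funext => e /=.
  by rewrite -(space_elemB o o) subrr linear0.
have g_pred : g \in Lip0_pred o (F := dual E).
  by rewrite inE; split=> //; exists 1.
exists (MkLip0 g_pred).
  by apply: ge_inf => //; exists 0 => C [].
move=> w; have [s ws] := (lip_tensorP _).1 (lip_tensor_valP w).
have wE : w = \sum_(p <- s) space_elem o p.1.1 p.1.2 p.2.
  by apply/val_inj; rewrite raddf_sum; exact: ws.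
rewrite ws tensor_ofE wE linear_sum; apply: eq_bigr => q _ /=.
by rewrite -gB.
Qed.
End Representation.

Theorem corollary6p3 (R : realType) (k : scalar_kind) (X : metricType R)
    (o : X) (E : completeNormedModType (scalar_field R k))
    (u : algdual (Lip0 o (dual E))) (hu : lip_tensor o E u) :
  lip_projective_norm u = lip_dual_norm u.
Proof.
apply/eqP; rewrite eq_le lip_dual_norm_le// andbT.
have huE : u \in @lip_tensor_pred R k X o E by rewrite inE.
pose p (w : lip_tensor_space o E) := lip_projective_norm (w : algdual _).
have [||Phi [PhiP Phiu]] := @hahn_banach _ _ _ p (LipTensor huE).
- by move=> v w; apply: lip_projective_normD; exact: lip_tensor_valP.
- by move=> c w; apply: lip_projective_normZ; exact: lip_tensor_valP.
have [f f1 fE] := bounded_functional_eval PhiP.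
apply: le_trans Phiu _; rewrite fE; apply: ub_le_sup; last by exists f.
by exists (lip_projective_norm u) => _ [g g1 <-]; exact: lip_tensor_eval_le.
Qed.
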